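(* Let $\mathcal{X}=[0,1]$. For any $\gamma\ge0$ and $K\in(0,1]$, we have the inclusion $$\mathcal{T}(\gamma,K)\subset\mathcal{D}\big(\gamma+1,\tfrac{2}{K}\big).$$
   Context: $[0,1]$ carries the metric $|x-x'|$, and $\mathsf{B}(x,h)=\{x'\in[0,1]:|x-x'|\le h\}$. $P,Q$ denote Borel probability measures on $[0,1]$. Transfer exponent class: for $\gamma\ge0$ and $K\in(0,1]$, $\mathcal{T}(\gamma,K)$ is the set of all pairs $(P,Q)$ such that $P(\mathsf{B}(x,h))\ge K\,h^\gamma\,Q(\mathsf{B}(x,h))$ for all $x$ in the support of $Q$ and all $h\in(0,1]$. Similarity measure: $\rho_h(P,Q)=\int_{[0,1]}\frac{1}{P(\mathsf{B}(x,h))}\,dQ(x)$ for $h>0$ (with $1/0=+\infty$). For $\alpha\ge1$, $C\ge1$: $\mathcal{D}(\alpha,C)=\{(P,Q):\ \sup_{0<h\le1}h^\alpha\rho_h(P,Q)\le C\}$. *)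

(* Defs.v *)
From HB Require Import structures.
From mathcomp Require Import all_boot all_order all_algebra.
From mathcomp Require Import all_classical all_reals all_analysis.

Set Implicit Arguments.
Unset Strict Implicit.
Unset Printing Implicit Defensive.

Import Order.TTheory GRing.Theory Num.Theory.
Import numFieldNormedType.Exports.

Local Open Scope classical_set_scope.
Local Open Scope ring_scope.

Section transfer.
Context {R : realType}.

(* A Borel probability measure on [0,1] is represented by a Borel probability
   measure on the real line that gives mass 1 to [0,1]. *)
Definition borel_prob : Type := probability (measurableTypeR R) R.

Definition on_unit (P : borel_prob) : Prop := P `[0, 1]%classic = 1%E.

Definition cball01 (x h : R) : set R := [set x' | x' \in `[0, 1] /\ `|x - x'| <= h].

(* The sets `[0, 1] `&` U with U open in R are the open subsets of [0,1]. *)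
Definition msupport (Q : borel_prob) : set R :=
  [set x | x \in `[0, 1] /\
    forall U : set R, open U -> U x -> (0 < Q (`[0%R, 1%R]%classic `&` U))%E].

Definition transfer_class (gamma K : R) : set (borel_prob * borel_prob) :=
  [set PQ | [/\ on_unit PQ.1, on_unit PQ.2 &
    forall x h : R, msupport PQ.2 x -> 0 < h <= 1 ->
      ((K * h `^ gamma)%:E * PQ.2 (cball01 x h) <= PQ.1 (cball01 x h))%E]].

(* The inverse on \bar R satisfies 0^-1 = +oo (lemma inve0). *)
Definition rho (h : R) (P Q : borel_prob) : \bar R :=
  (\int[Q]_(x in `[0%R, 1%R]) (P (cball01 x h))^-1)%E.

Definition similarity_class (alpha C : R) : set (borel_prob * borel_prob) :=
  [set PQ | [/\ on_unit PQ.1, on_unit PQ.2 &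
    (ereal_sup [set (h `^ alpha)%:E * rho h PQ.1 PQ.2 | h in `]0%R, 1%R]]
       <= C%:E)%E]].

End transfer.

(* Main.v *)
(** Cut [0,1] into [floor(1/h) + 1 <= 2/h] cells of length [h].  For [x] in the
    support of [Q] and in the cell [A], the ball [B(x,h)] contains [A], so the
    transfer condition gives [1 / P(B(x,h)) <= 1 / (K h^gamma Q(A))], whose
    [Q]-integral over [A] is at most [1 / (K h^gamma)].  The support has full
    [Q]-measure since its complement is covered by countably many null
    intervals with rational endpoints.  The measurability of
    [x |-> 1 / P(B(x,h))] is never needed: the library's integral of a
    nonnegative function is a supremum over the simple functions below it, so
    only the dominating function must be measurable. *)
Require Import Defs.
From mathcomp Require Import all_boot all_order all_algebra.
From mathcomp Require Import all_classical all_reals all_analysis.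
From mathcomp Require Import measurable_realfun ring lra.

Local Open Scope classical_set_scope.
Local Open Scope ring_scope.

Import Order.TTheory GRing.Theory Num.Theory.
Import numFieldNormedType.Exports.

Lemma ge0_le_nonmeasurable_integral (d : measure_display)
    (T : measurableType d) (R : realType) (mu : {measure set T -> \bar R})
    (D : set T) (f g : T -> \bar R) :
  (forall x, D x -> (0 <= f x)%E) ->
  (forall x, D x -> (f x <= g x)%E) ->
  (\int[mu]_(x in D) f x <= \int[mu]_(x in D) g x)%E.
Proof.
move=> f0 fg.
have g0 x : D x -> (0 <= g x)%E.
  by move=> Dx; exact: le_trans (f0 x Dx) (fg x Dx).
rewrite !ge0_integralE//; apply: ereal_sup_le => _ [s sf <-].
exists s => // x; apply: le_trans (sf x) _.
by rewrite !patchE; case: ifPn => // /set_mem; exact: fg.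
Qed.

(** Adding to [g] the function [b], equal to [+oo] on the exceptional null set [B] and to 0
    elsewhere, makes the bound hold everywhere on [D]. The integral does not change, since [b]
    contributes [+oo * 0 = 0]. *)
Lemma ge0_ae_le_nonmeasurable_integral (d : measure_display)
    (T : measurableType d) (R : realType) (mu : {measure set T -> \bar R})
    (D : set T) (f g : T -> \bar R) :
  measurable D -> measurable_fun D g ->
  (forall x, D x -> (0 <= f x)%E) ->
  (forall x, D x -> (0 <= g x)%E) ->
  {ae mu, forall x, D x -> (f x <= g x)%E} ->
  (\int[mu]_(x in D) f x <= \int[mu]_(x in D) g x)%E.
Proof.
move=> mD mg f0 g0 [B [mB B0 fgB]].
pose b (x : T) : \bar R := (+oo * (\1_B x)%:E)%E.
have b0 x : (0 <= b x)%E by rewrite /b mule_ge0// lee_fin.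
have mindic : measurable_fun D (fun x => (\1_B x : R)%:E).
  by apply/measurable_EFinP; exact: measurable_indic.
have mb : measurable_fun D b by exact: emeasurable_funM.
have -> : (\int[mu]_(x in D) g x = \int[mu]_(x in D) (g x + b x))%E.
  rewrite ge0_integralD// ge0_integralZl// integral_indic//.
  rewrite (_ : mu (B `&` D) = 0%E) ?mule0 ?adde0//.
  by apply: (subset_measure0 _ mB); [exact: measurableI| |].
apply: ge0_le_nonmeasurable_integral => // x Dx; rewrite /b indicE.
have [xB|/negP xB] := boolP (x \in B).
  by rewrite mule1 addey ?leey// gt_eqF// (lt_le_trans _ (g0 x Dx)).
rewrite mule0 adde0; apply: contrapT => nfg; apply: xB; apply/mem_set/fgB.
by move=> /(_ Dx).
Qed.

(* Each cell contributes at most [c^-1]; a null cell contributes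
   [+oo * 0 = 0]. *)
Lemma ge0_integral_inv_cover_le (d : measure_display)
    (T : measurableType d) (R : realType) (mu : probability T R)
    (D : set T) (n : nat) (A : 'I_n -> set T) (c : R) (f : T -> \bar R) :
  measurable D -> (forall i, measurable (A i)) -> 0 < c ->
  (forall x, D x -> (0 <= f x)%E) ->
  {ae mu, forall x, D x ->
    exists2 i, A i x & (f x <= (c%:E * mu (A i))^-1)%E} ->
  (\int[mu]_(x in D) f x <= (n%:R / c)%:E)%E.
Proof.
move=> mD mA c0 f0 fA.
pose t (i : 'I_n) (x : T) : \bar R :=
  ((c%:E * mu (A i))^-1 * (\1_(A i) x)%:E)%E.
have k0 i : (0 <= (c%:E * mu (A i))^-1)%E.
  by rewrite inve_ge0 mule_ge0// lee_fin ltW.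
have t0 i x : (0 <= t i x)%E by rewrite /t mule_ge0// lee_fin.
have mindic i : measurable_fun D (fun x => (\1_(A i) x : R)%:E).
  by apply/measurable_EFinP; exact: measurable_indic.
have mt i : measurable_fun D (t i) by exact: emeasurable_funM.
apply: (@le_trans _ _ (\int[mu]_(x in D) (\sum_(i < n) t i x))%E).
  apply: ge0_ae_le_nonmeasurable_integral => //.
  - exact: emeasurable_sum.
  - by move=> x _; exact: sume_ge0.
  (* The sets [A i] may overlap: one that contains [x] already gives the bound, and the other
     summands are nonnegative. *)
  - apply: filterS fA => x + Dx => /(_ Dx)[i Aix] /le_trans; apply.
    rewrite (bigD1 i)//= {1}/t indicE mem_set// mule1.
    by rewrite leeDl// sume_ge0.
rewrite ge0_integral_sum//.
apply: (@le_trans _ _ (\sum_(i < n) (c^-1)%:E)%E); last first.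
  by rewrite sumEFin sumr_const card_ord mulr_natl.
apply: lee_sum => i _; rewrite ge0_integralZl// integral_indic//.
have mAD : (mu (A i `&` D) <= mu (A i))%E.
  by apply: le_measure; rewrite ?inE//; exact: measurableI.
apply: le_trans (lee_wpmul2l (k0 i) mAD) _.
have [->|A0] := eqVneq (mu (A i)) 0%E.
  by rewrite mule0 lee_fin invr_ge0 ltW.
have : mu (A i) \is a fin_num by exact: fin_num_measure.
case: (mu (A i)) A0 => [r r0 _|_ /fin_numP[]|_ /fin_numP[]] //.
rewrite -EFinM inver mulf_eq0 gt_eqF//= ifF; last by apply/negbTE.
by rewrite -EFinM lee_fin invfM mulfVK.
Qed.

Lemma negligible_nmsupport {R : realType} (Q : @borel_prob R) :
  Q.-negligible (`[0, 1]%classic `\` msupport Q).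
Proof.
pose I (k : nat) : set R :=
  if (unpickle k : option (rat * rat)) is Some (a, b)
  then `](ratr a : R), (ratr b)[%classic else set0.
(* Only the null intervals are kept, so the union of the [F k] is negligible by construction. *)
pose F (k : nat) : set R :=
  if Q (`[0, 1]%classic `&` I k) == 0%E then `[0, 1]%classic `&` I k else set0.
have mI k : measurable (I k : set (measurableTypeR R)).
  rewrite /I; case: unpickle => [[a b]|]; last exact: measurable0.
  exact: measurable_itv.
have mJ k : measurable (`[0, 1]%classic `&` I k : set (measurableTypeR R)).
  by apply: measurableI => //; exact: measurable_itv.
apply: (@negligibleS _ _ _ Q (\bigcup_k F k)); last first.
  apply: negligible_bigcup => k; rewrite /F; case: ifPn => [/eqP|_].
    by move/negligibleP; apply.
  exact: negligible_set0.
(* A point of [[0, 1]] outside every [F k] is in the support: each open [U] around it contains a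
   rational interval around it, which was not discarded for being non-null. *)
move=> /= x; move: (x : R) => {}x [x01 xQ]; apply: contrapT => nF; apply: xQ; split.
  by rewrite inE.
move=> U oU Ux.
have /nbhs_ballP[e /= e0 eU] : nbhs x U by exact: open_nbhs_nbhs.
have [a] := @rat_in_itvoo R (x - e) x ltac:(lra).
rewrite in_itv/= => /andP[a1 a2].
have [b] := @rat_in_itvoo R x (x + e) ltac:(lra).
rewrite in_itv/= => /andP[b1 b2].
have [k Ik] : exists k, I k = `](ratr a : R), (ratr b)[%classic.
  by exists (pickle (a, b)); rewrite /I pickleK.
have IU : I k `<=` U.
  move=> y; rewrite Ik /= in_itv/= => /andP[ay yb]; apply: eU.
  by rewrite /ball/= ltr_distlC; apply/andP; split; lra.
have Ikx : I k x by rewrite Ik /= in_itv/= a2 b1.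
have Qk : (0 < Q (`[0%R, 1%R]%classic `&` I k))%E.
  rewrite lt0e measure_ge0 andbT; apply/negP => Qk0.
  by apply: nF; exists k => //; rewrite /F Qk0.
apply: lt_le_trans Qk _; apply: le_measure; rewrite ?inE//.
- apply: measurableI; first exact: measurable_itv.
  exact: open_measurable.
- exact: setIS.
Qed.

Lemma cball01E {R : realType} (x h : R) :
  cball01 x h = `[0, 1]%classic `&` `[x - h, x + h]%classic.
Proof.
apply/seteqP; split => y /=.
  by move=> []; rewrite ler_distlC !in_itv.
by move=> [? ?]; rewrite /cball01/= ler_distlC; split.
Qed.

Lemma measurable_cball01 {R : realType} (x h : R) :
  measurable (cball01 x h : set (measurableTypeR R)).
Proof. by rewrite cball01E; apply: measurableI; exact: measurable_itv. Qed.

Lemma transfer_class_rho_le {R : realType} (gamma K h : R)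
    (P Q : @borel_prob R) :
  0 < K -> 0 < h <= 1 -> transfer_class gamma K (P, Q) ->
  (rho h P Q <= (2 / (h * (K * h `^ gamma)))%:E)%E.
Proof.
move=> K0 /andP[h0 h1] [_ _ /= PQ].
have c0 : 0 < K * h `^ gamma by rewrite mulr_gt0// powR_gt0.
(* The cells are half-open and numbered 0 to [n]; the point 1 lies in the last one, even when [h^-1]
   is an integer. *)
pose n := Num.truncn h^-1.
pose A (i : 'I_n.+1) : set (measurableTypeR R) :=
  `[0, 1]%classic `&` `[i%:R * h, i.+1%:R * h[%classic.
have mA i : measurable (A i) by apply: measurableI; exact: measurable_itv.
have nh : n%:R * h <= 1.
  by rewrite -ler_pdivlMr// div1r truncn_le invr_ge0 ltW.
(* The constant 2 arises here: [n * h <= 1] and [h <= 1] give [(n + 1) * h <= 2]. *)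
apply: (@le_trans _ _ (n.+1%:R / (K * h `^ gamma))%:E); last first.
  rewrite lee_fin (invfM h) mulrA ler_wpM2r ?invr_ge0 ?(ltW c0)//.
  by rewrite ler_pdivlMr// -natr1 mulrDl mul1r; lra.
apply: (@ge0_integral_inv_cover_le _ _ _ Q _ _ A) => //.
  by move=> x _; rewrite inve_ge0.
apply: negligibleS (negligible_nmsupport Q) => /= x.
move: (x : R) => {}x nx.
have x01 : `[0, 1]%classic x by apply: contrapT => nx01; apply: nx.
split=> // Qx; apply: nx => _.
have /andP[x0 x1] : 0 <= x <= 1 by move: x01; rewrite /= in_itv.
have xh0 : 0 <= x / h by rewrite divr_ge0// ltW.
have ltn : (Num.truncn (x / h) < n.+1)%N.
  by rewrite ltnS /n; apply: le_truncn; rewrite ler_pdivrMr// mulVf// gt_eqF.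
have /andP[ix xi] := truncn_itv xh0.
exists (Ordinal ltn).
  by split => //=; rewrite in_itv/= -ler_pdivlMr// ix -ltr_pdivrMr.
have c0' := ltW c0.
(* Inversion reverses the order, so it remains to bound [P (cball01 x h)] from below: the transfer
   condition at [x] applies, and the cell of [x], having length [h], lies in the ball. *)
rewrite lee_pV2 ?inE ?mule_ge0 ?lee_fin//.
apply: le_trans (PQ x h Qx _); last by rewrite h0.
apply: lee_wpmul2l; first by rewrite lee_fin.
apply: le_measure; rewrite ?inE//; first exact: measurable_cball01.
rewrite cball01E; apply: setIS => y /=; rewrite !in_itv/=.
move: ix xi; rewrite ler_pdivlMr// ltr_pdivrMr// -natr1 !mulrDl mul1r.
by move=> ix xi /andP[iy yi]; apply/andP; split; lra.
Qed.

Theorem lemma1 (R : realType) (gamma K : R) (hgamma : 0 <= gamma)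
    (hK0 : 0 < K) (hK1 : K <= 1) :
  transfer_class gamma K `<=` similarity_class (gamma + 1) (2 / K).
Proof.
move=> [P Q] PQ; have [P1 Q1 _] := PQ; split => //=.
apply: ge_ereal_sup => _ [h + <-]; rewrite /= in_itv/= => h01.
have /andP[h0 _] := h01.
apply: le_trans (lee_wpmul2l _ (transfer_class_rho_le _ _ _ _ _ hK0 h01 PQ)) _.
  by rewrite lee_fin powR_ge0.
rewrite -EFinM lee_fin powRD; last by rewrite (gt_eqF h0) /= implybT.
have hg : 0 < h `^ gamma by exact: powR_gt0.
rewrite powRr1 ?(ltW h0)//.
suff -> : h `^ gamma * h * (2 / (h * (K * h `^ gamma))) = 2 / K by [].
by field; rewrite !gt_eqF.
Qed.
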